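(* Let $q$ be a complex number with $|q|<1$, fix a square root $q^{1/2}$ and a fourth root $q^{1/4}$ with $(q^{1/4})^2=q^{1/2}$, and write $q^{k/2}=(q^{1/2})^k$, $q^{k/4}=(q^{1/4})^k$ for integers $k$. Define $$S_1(q)=q^{1/4}\frac{\mathfrak f(-q^3,-q^{11})}{\mathfrak f(-q^4,-q^{10})},\quad S_2(q)=q^{3/4}\frac{\mathfrak f(-q^2,-q^{12})}{\mathfrak f(-q^5,-q^{9})},\quad S_3(q)=q^{5/4}\frac{\mathfrak f(-q,-q^{13})}{\mathfrak f(-q^6,-q^{8})},$$ and let $S_i(q^2)$ denote the same expressions with $q$ replaced by $q^2$, the prefactors becoming $q^{1/2},q^{3/2},q^{5/2}$ respectively. Then \begin{enumerate} \item[(i)] $\dfrac{1}{S_1(q)}-S_1(q)=\dfrac{\phi(q^{7/2})\,\mathfrak f(-q^{1/2},-q^{13/2})}{q^{1/4}\psi(q^7)\,\mathfrak f(-q^3,-q^4)}$, \item[(ii)] $\dfrac{1}{S_1(q)}+S_1(q)=\dfrac{\phi(-q^{7/2})\,\mathfrak f(q^{1/2},q^{13/2})}{q^{1/4}\psi(q^7)\,\mathfrak f(-q^3,-q^4)}$, \item[(iii)] $\dfrac{1}{S_2(q)}-S_2(q)=\dfrac{\phi(q^{7/2})\,\mathfrak f(-q^{3/2},-q^{11/2})}{q^{3/4}\psi(q^7)\,\mathfrak f(-q^2,-q^5)}$, \item[(iv)] $\dfrac{1}{S_2(q)}+S_2(q)=\dfrac{\phi(-q^{7/2})\,\mathfrak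 f(q^{3/2},q^{11/2})}{q^{3/4}\psi(q^7)\,\mathfrak f(-q^2,-q^5)}$, \item[(v)] $\dfrac{1}{S_3(q)}-S_3(q)=\dfrac{\phi(q^{7/2})\,\mathfrak f(-q^{5/2},-q^{9/2})}{q^{5/4}\psi(q^7)\,\mathfrak f(-q,-q^6)}$, \item[(vi)] $\dfrac{1}{S_3(q)}+S_3(q)=\dfrac{\phi(-q^{7/2})\,\mathfrak f(q^{5/2},q^{9/2})}{q^{5/4}\psi(q^7)\,\mathfrak f(-q,-q^6)}$, \item[(vii)] $\displaystyle\prod_{i=1}^{3}\left(\frac{1}{S_i(q^2)}-S_i(q^2)\right)=\frac{\phi^3(q^7)\psi(q^7)}{q^{9/2}\psi^3(q^{14})\psi(q)}$, \item[(viii)] $\displaystyle\prod_{i=1}^{3}\left(\frac{1}{S_i(q^2)}+S_i(q^2)\right)=\frac{\phi^3(-q^7)\psi(-q^7)}{q^{9/2}\psi^3(q^{14})\psi(-q)}$. \end{enumerate}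
   Context: For complex $\lambda$ and $|q|<1$, $(\lambda;q)_\infty=\prod_{t\ge0}(1-\lambda q^t)$. Ramanujan's general theta function is $\mathfrak f(a,b)=\sum_{t=-\infty}^{\infty}a^{t(t+1)/2}b^{t(t-1)/2}$ for $|ab|<1$; by Jacobi's triple product $\mathfrak f(a,b)=(-a;ab)_\infty(-b;ab)_\infty(ab;ab)_\infty$. Further $\phi(q)=\mathfrak f(q,q)=\sum_{t\in\mathbb Z}q^{t^2}$ and $\psi(q)=\mathfrak f(q,q^3)=\sum_{t\ge0}q^{t(t+1)/2}=(q^2;q^2)_\infty/(q;q^2)_\infty$. Arguments such as $q^{7/2}$, $q^{1/2}$, $q^{13/2}$ are understood via the fixed root $q^{1/2}$. *)

(* Defs.v *)
From mathcomp Require Import all_boot all_order all_algebra.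
From mathcomp Require Import all_classical all_reals all_analysis.

Set Implicit Arguments.
Unset Strict Implicit.
Unset Printing Implicit Defensive.

Import Order.TTheory GRing.Theory Num.Theory.
Import numFieldNormedType.Exports.

Local Open Scope ring_scope.

(* Everything is stated over a numFieldType K, whose limits are taken for the
   topology of its norm; the intended instance is K = R[i] with R : realType,
   on which this topology is not found by canonical structures directly. *)

(* Sum over all of Z, as the sum of two one-sided series.  For the theta
   series below both converge absolutely when |ab| < 1. *)
Definition bilateral_sum (K : numFieldType) (u : int -> K) : K :=
  limn (series (fun n : nat => u (Posz n))) +
  limn (series (fun n : nat => u (Negz n))).

(* Both exponents are nonnegative integers and the divisions by 2 are exact;
   [a ^ m] with [m : int] satisfies [0 ^ 0 = 1]. *)
Definition ftheta (K : numFieldType) (a b : K) : K :=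
  bilateral_sum (fun t : int =>
    a ^ ((t * (t + 1)) %/ 2)%Z * b ^ ((t * (t - 1)) %/ 2)%Z).

Definition phi (K : numFieldType) (q : K) : K := ftheta q q.

Definition psi (K : numFieldType) (q : K) : K := ftheta q (q ^+ 3).

(* In [S1 x q], [S2 x q] and [S3 x q], the argument [x] is the chosen value
   of q^(1/4). *)
Definition S1 (K : numFieldType) (x q : K) : K :=
  x * (ftheta (- q ^+ 3) (- q ^+ 11) / ftheta (- q ^+ 4) (- q ^+ 10)).

Definition S2 (K : numFieldType) (x q : K) : K :=
  x ^+ 3 * (ftheta (- q ^+ 2) (- q ^+ 12) / ftheta (- q ^+ 5) (- q ^+ 9)).

Definition S3 (K : numFieldType) (x q : K) : K :=
  x ^+ 5 * (ftheta (- q) (- q ^+ 13) / ftheta (- q ^+ 6) (- q ^+ 8)).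

(* Main.v *)
(* With s = q^(k/4), k = 1, 3, 5, each S is s B / A for two theta functions A and
   B, so that 1/S - S = (A^2 - s^2 B^2) / (s A B).  Separating the even and odd
   indices of a theta series gives A + s B = f(s, s e) and A - s B = f(-s, -s e)
   with e = -q^((7-k)/2), and Jacobi's triple product evaluates both
   f(s, s e) f(-s, -s e) and A B: this is (i), (iii) and (v).  Replacing q^(1/4)
   by i q^(1/4) multiplies S by i^k, hence turns 1/S - S into 1/S + S up to a
   constant, which gives (ii), (iv), (vi), and (viii) from (vii).  In the product
   (vii) there remains a quotient of theta functions that the triple product
   evaluates.  The triple product itself is the termwise limit, by Tannery's
   theorem, of a finite identity between Gaussian binomials. *)

Require Import Defs.
From mathcomp Require Import all_boot all_order all_algebra.
From mathcomp Require Import complex.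
From mathcomp Require Import all_classical all_reals all_analysis.
From mathcomp Require Import ring zify.

Set Implicit Arguments.
Unset Strict Implicit.
Unset Printing Implicit Defensive.

Import Order.TTheory GRing.Theory Num.Theory.
Import numFieldNormedType.Exports.

Local Open Scope classical_set_scope.
Local Open Scope ring_scope.

(** * Finite sums, binomials and signs *)

Lemma sum_nat_even_odd (V : nmodType) (F : nat -> V) n :
  \sum_(0 <= k < n.*2) F k =
  \sum_(0 <= k < n) F k.*2 + \sum_(0 <= k < n) F k.*2.+1.
Proof.
elim: n => [|n IH]; first by rewrite !big_geq// addr0.
by rewrite doubleS !big_nat_recr//= IH -addrA addrACA.
Qed.

Lemma subr_sum_le_prod (K : numDomainType) (u : nat -> K) m n :
  (forall k, (m <= k < n)%N -> 0 <= u k <= 1) ->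
  1 - \sum_(m <= k < n) u k <= \prod_(m <= k < n) (1 - u k).
Proof.
have [nm _|/ltnW mn] := leqP n m; first by rewrite !big_geq// subr0.
rewrite -(subnKC mn); elim: (n - m)%N => [_|k IH u01].
  by rewrite addn0 !big_geq// subr0.
have /andP[uk_ge0 _] : 0 <= u (m + k)%N <= 1 by rewrite u01// leq_addr addnS /=.
have {}u01 i : (m <= i < m + k)%N -> 0 <= u i <= 1.
  by move=> /andP[mi ik]; rewrite u01// mi addnS ltnW.
rewrite addnS !big_nat_recr ?leq_addr//= mulrBr mulr1 opprD addrA lerB ?IH//.
rewrite ler_piMl// big_nat_cond prodr_ile1// => i.
move=> /andP[/u01/andP[ui_ge0 ui_le1] _].
by rewrite subr_ge0 ui_le1 gerBl.
Qed.

Lemma bin2_double n : ('C(n.+1, 2) * 2 = n.+1 * n)%N.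
Proof. by rewrite mulnC -mul_bin_diag bin1. Qed.

Lemma bin2_odd n : 'C(n.*2.+1, 2) = ('C(n.+1, 2) * 3 + 'C(n, 2))%N.
Proof.
case: n => // n.
by move: (bin2_double n) (bin2_double n.+1) (bin2_double n.+1.*2); lia.
Qed.

Lemma bin2_even n : 'C(n.*2, 2) = ('C(n.+1, 2) + 'C(n, 2) * 3)%N.
Proof.
case: n => // n; rewrite doubleS.
by move: (bin2_double n) (bin2_double n.+1) (bin2_double n.*2.+1); lia.
Qed.

Lemma exprN_even (R : pzRingType) (x : R) n : ~~ odd n -> (- x) ^+ n = x ^+ n.
Proof. by move=> /negbTE n_even; rewrite exprNn -signr_odd n_even mul1r. Qed.

Lemma exprN_odd (R : pzRingType) (x : R) n : odd n -> (- x) ^+ n = - x ^+ n.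
Proof. by move=> n_odd; rewrite exprNn -signr_odd n_odd mulN1r. Qed.

Lemma sqrN1_neq0 (F : fieldType) (i : F) : i ^+ 2 = -1 -> i != 0.
Proof.
by apply: contra_eq_neq => ->; rewrite expr0n eq_sym oppr_eq0 oner_eq0.
Qed.

Lemma mulf_div_cancel (F : fieldType) (u v w : F) :
  u != 0 -> u * (v / (u * w)) = v / w.
Proof. by move=> u_neq0; rewrite invfM mulrCA mulVKf. Qed.

(* Also valid when [u] or [v] is [0]: both sides are then [0], as [x / 0 = 0]. *)
Lemma inv_sub_div (F : fieldType) (u v : F) :
  (u / v)^-1 - u / v = (v ^+ 2 - u ^+ 2) / (u * v).
Proof.
have [->|u_neq0] := eqVneq u 0; first by rewrite !mul0r !invr0 mulr0 subr0.
have [->|v_neq0] := eqVneq v 0; first by rewrite invr0 !mulr0 invr0 subr0 mulr0.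
by field; rewrite u_neq0 v_neq0.
Qed.

(** * Absolute summability *)

Definition abs_summable (K : numFieldType) (u : K ^nat) : Prop :=
  exists M : K, forall n, \sum_(0 <= k < n) `|u k| <= M.

(* Over [R[i]] the norm takes its values in the field itself, so that the
   library's completeness results, which are for modules normed by a [realType],
   do not apply. *)
Definition abs_complete (K : numFieldType) : Prop :=
  forall u : K ^nat, abs_summable u -> cvgn (series u).

Section AbsSummable.
Variable K : numFieldType.
Implicit Types (u v : K ^nat) (c r : K).

Lemma abs_summable_near_le u v :
  (\forall n \near \oo, `|u n| <= `|v n|) -> abs_summable v -> abs_summable u.
Proof.
move=> [N _ uv] [M vM]; exists (\sum_(0 <= k < N) `|u k| + M) => n.
have [nN|/ltnW Nn] := leqP n N.
  rewrite (big_cat_nat (n := n) (p := N))//= -addrA lerDl addr_ge0 ?sumr_ge0//.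
  by rewrite (le_trans _ (vM n)) ?sumr_ge0.
rewrite (big_cat_nat (n := N))//= lerD2l (le_trans _ (vM n))//.
rewrite [leRHS](big_cat_nat (n := N))//= ler_wpDl ?sumr_ge0//.
by apply: ler_sum_nat => k /andP[Nk _]; exact: uv.
Qed.

Lemma abs_summable_le u v :
  (forall n, `|u n| <= `|v n|) -> abs_summable v -> abs_summable u.
Proof. by move=> uv; apply: abs_summable_near_le; exists 0%N => // n _. Qed.

Lemma abs_summableD u v :
  abs_summable u -> abs_summable v -> abs_summable (u + v).
Proof.
move=> [M uM] [N vN]; exists (M + N) => n; apply: le_trans (lerD (uM n) (vN n)).
by rewrite -big_split /= ler_sum// => k _; exact: ler_normD.
Qed.

Lemma abs_summableZ c u : abs_summable u -> abs_summable (fun n => c * u n).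
Proof.
move=> [M uM]; exists (`|c| * M) => n; under eq_bigr do rewrite normrM.
by rewrite -mulr_sumr ler_wpM2l.
Qed.

Lemma abs_summable_norm u : abs_summable u -> abs_summable (fun n => `|u n|).
Proof. by apply: abs_summable_le => n; rewrite normr_id. Qed.

Lemma abs_summableS u : abs_summable u -> abs_summable (fun n => u n.+1).
Proof.
move=> [M uM]; exists M => n; apply: le_trans (uM n.+1).
by rewrite [leRHS]big_nat_recl// lerDr.
Qed.

Lemma abs_summable_even u : abs_summable u -> abs_summable (fun n => u n.*2).
Proof.
move=> [M uM]; exists M => n; apply: le_trans (uM n.*2).
by rewrite (sum_nat_even_odd (fun k => `|u k|)) lerDl sumr_ge0.
Qed.

Lemma abs_summable_odd u : abs_summable u -> abs_summable (fun n => u n.*2.+1).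
Proof.
move=> [M uM]; exists M => n; apply: le_trans (uM n.*2).
by rewrite (sum_nat_even_odd (fun k => `|u k|)) lerDr sumr_ge0.
Qed.

Lemma abs_summable_geometric c r : `|r| < 1 -> abs_summable (geometric c r).
Proof.
move=> r_lt1; apply: abs_summableZ.
have compl_gt0 : 0 < 1 - `|r| by rewrite subr_gt0.
exists (1 - `|r|)^-1 => n; under eq_bigr do rewrite normrX.
rewrite -(ler_pM2l compl_gt0) mulfV ?gt_eqF// big_mkord.
by rewrite -opprB mulNr -subrX1 opprB gerBl exprn_ge0.
Qed.

Lemma abs_summable_ratio u r : 0 < r < 1 ->
  (\forall n \near \oo, `|u n.+1| <= r * `|u n|) -> abs_summable u.
Proof.
move=> /andP[r_gt0 r_lt1] [N _ ur].
have norm_r_lt1 : `|r| < 1 by rewrite gtr0_norm.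
apply: abs_summable_near_le (abs_summable_geometric (`|u N| / r ^+ N) norm_r_lt1).
exists N => // n /= /subnKC <-; elim: (n - N)%N => [|k IH].
  by rewrite addn0 mulfVK ?gt_eqF ?exprn_gt0// normr_id.
rewrite addnS exprS mulrCA normrM (gtr0_norm r_gt0).
apply: le_trans (ur (N + k)%N (leq_addr k N)) _.
by rewrite ler_wpM2l ?(ltW r_gt0).
Qed.

End AbsSummable.

Section AbsComplete.
Variable K : numFieldType.
Hypothesis K_complete : abs_complete K.
Implicit Types (u v g : K ^nat) (a b c e p q s x y z : K).

Lemma abs_summable_tail u e : abs_summable u -> 0 < e ->
  \forall m \near \oo, forall n, \sum_(m <= k < n) `|u k| < e.
Proof.
move=> us e_gt0; have e2_gt0 : 0 < e / 2 by rewrite divr_gt0.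
have /K_complete/cvgrPdist_lt/(_ _ e2_gt0)[N _ near_lim] := abs_summable_norm us.
exists N => // m /= Nm n.
have [nm|/ltnW mn] := leqP n m; first by rewrite big_geq.
have -> : \sum_(m <= k < n) `|u k| =
    `|series (fun k => `|u k|) m - series (fun k => `|u k|) n|.
  by rewrite distrC sub_series_geq// ger0_norm ?sumr_ge0.
rewrite (splitr e).
apply: le_lt_trans (ler_distD (limn (series (fun k => `|u k|))) _ _) (ltrD _ _).
  by rewrite distrC; exact: near_lim.
by apply: near_lim; exact: leq_trans mn.
Qed.

Lemma tannery (u : nat -> K ^nat) v g (m : nat -> nat) :
  abs_summable g -> (forall n k, `|u n k| <= `|g k|) ->
  (forall k, u^~ k @ \oo --> v k) -> m @ \oo --> \oo ->
  (fun n => \sum_(0 <= k < m n) u n k) @ \oo --> limn (series v).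
Proof.
move=> gs ug uv my.
have vg k : `|v k| <= `|g k|.
  rewrite real_leNgt//; apply/negP => /(cvgr_norm_gt _ (uv k))[N _ gt_gk].
  by have := le_lt_trans (ug N k) (gt_gk N (leqnn N)); rewrite ltxx.
have cv : cvgn (series v) by apply: K_complete; exact: abs_summable_le gs.
apply/cvgrPdist_lt => e e_gt0; have e3_gt0 : 0 < e / 3 by rewrite divr_gt0.
have eE : e = e / 3 + (e / 3 + e / 3) by field.
near \oo => N.
have head : (fun n => \sum_(0 <= k < N) u n k) @ \oo --> series v N.
  by apply: cvg_big => [|k _]; [exact: add_continuous | exact: uv].
near=> n; have Nmn : (N <= m n)%N by near: n; move/cvgnyPge : my; exact.
rewrite [ltRHS]eE.
apply: le_lt_trans (ler_distD (series v N) _ _) _; apply: ltrD.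
  by near: N; exact: (cvgrPdist_lt _ _).1 cv _ e3_gt0.
rewrite (big_cat_nat (n := N))//= opprD addrA.
apply: le_lt_trans (ler_normB _ _) _; apply: ltrD.
  by near: n; exact: (cvgrPdist_lt _ _).1 head _ e3_gt0.
apply: le_lt_trans (ler_norm_sum _ _ _) _.
apply: le_lt_trans (ler_sum _ (fun k _ => ug n k)) _.
by move: (m n); near: N; exact: abs_summable_tail gs e3_gt0.
Unshelve. all: by end_near. Qed.

Lemma lim_series_even_odd u : abs_summable u ->
  limn (series u) =
  limn (series (fun n => u n.*2)) + limn (series (fun n => u n.*2.+1)).
Proof.
move=> us; rewrite -lim_seriesD; last 2 first.
- exact/K_complete/abs_summable_even.
- exact/K_complete/abs_summable_odd.
apply/esym/norm_cvg_lim; rewrite seriesD.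
have <- : series u \o double =
    series (fun n => u n.*2) + series (fun n => u n.*2.+1).
  by apply/funext => n; exact: sum_nat_even_odd.
apply: cvg_comp (K_complete us); apply/cvgnyPge => N.
by exists N => // n /= Nn; rewrite (leq_trans Nn)// -addnn leq_addr.
Qed.

(** * Infinite products *)

Lemma prod1B_norm_bounds u m n : \sum_(m <= k < n) `|u k| <= 2^-1 ->
  2^-1 <= `|\prod_(m <= k < n) (1 - u k)| <= 2.
Proof.
move=> u_half; have half_lt1 : 2^-1 < 1 :> K by rewrite invf_lt1 ?ltr1n.
have u01 k : (m <= k < n)%N -> 0 <= `|u k| < 1.
  move=> mkn; rewrite normr_ge0 (le_lt_trans _ half_lt1)// (le_trans _ u_half)//.
  by rewrite (big_rem k) ?mem_index_iota//= lerDl sumr_ge0.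
have prod_ge : 2^-1 <= \prod_(m <= k < n) (1 - `|u k|).
  apply: le_trans (subr_sum_le_prod _) => [|k /u01/andP[-> /ltW]//].
  by rewrite lerBrDr (le_trans (lerD (lexx _) u_half))// -div1r -splitr.
rewrite normr_prod; apply/andP; split.
  rewrite (le_trans prod_ge)// !big_nat ler_prod// => k /u01/andP[_ uk_lt1].
  by rewrite subr_ge0 (ltW uk_lt1) -{1}(normr1 K) lerB_dist.
rewrite -[leRHS]invrK (le_trans (y := (\prod_(m <= k < n) (1 - `|u k|))^-1))//.
  rewrite -prodfV !big_nat ler_prod// => k /u01/andP[_ uk_lt1].
  rewrite normr_ge0/= (le_trans (ler_normB _ _))// normr1.
  rewrite -[leRHS]mul1r ler_pdivlMr ?subr_gt0// mulrC -subr_sqr expr1n.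
  by rewrite gerBl exprn_ge0.
by rewrite lef_pV2 ?posrE// (lt_le_trans _ prod_ge).
Qed.

Lemma prod1B_norm_near_bounds u : abs_summable u ->
  exists m, let P n := \prod_(0 <= k < n) (1 - u k) in
    forall n, (m <= n)%N -> 2^-1 * `|P m| <= `|P n| <= 2 * `|P m|.
Proof.
move=> us; have half_gt0 : 0 < 2^-1 :> K by rewrite invr_gt0.
have [m _ /(_ m (leqnn m)) tail] := abs_summable_tail us half_gt0.
exists m => P n mn; rewrite {}/P (big_cat_nat (n := m) (p := n))//= normrM.
have /andP[ge_half le2] := prod1B_norm_bounds (ltW (tail n)).
by rewrite (mulrC 2^-1) (mulrC 2) !ler_wpM2l.
Qed.

Lemma is_cvg_prod1B u : abs_summable u ->
  cvgn (fun n => \prod_(0 <= k < n) (1 - u k)).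
Proof.
move=> us; have [m P_bounds] := prod1B_norm_near_bounds us.
set P := fun n => _ in P_bounds *.
have -> : P = cst (P 0%N) + series (telescope P).
  by apply/funext => n; exact: eq_sum_telescope.
apply: is_cvgD; first exact: is_cvg_cst.
apply: K_complete; apply: abs_summable_near_le (abs_summableZ (2 * `|P m|) us).
exists m => // n /P_bounds/andP[_ Pn].
have -> : telescope P n = - (P n * u n).
  by rewrite /telescope /P /= big_nat_recr//=; ring.
by rewrite normrN !normrM normr_id normr_nat ler_wpM2r.
Qed.

Lemma lim_prod1B_neq0 u : abs_summable u -> (forall k, u k != 1) ->
  limn (fun n => \prod_(0 <= k < n) (1 - u k)) != 0.
Proof.
move=> us u_neq1; have [m P_bounds] := prod1B_norm_near_bounds us.
set P := fun n => _ in P_bounds *.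
have Pm_gt0 : 0 < 2^-1 * `|P m|.
  rewrite mulr_gt0 ?invr_gt0// normr_gt0.
  by rewrite prodf_seq_neq0; apply/allP => k _ /=; rewrite subr_eq0 eq_sym.
apply/eqP => limP0; have := is_cvg_prod1B us; rewrite -/P limP0 => /cvgrPdist_lt.
move=> /(_ _ Pm_gt0)[N _ /(_ (maxn m N) (leq_maxr _ _))]; rewrite sub0r normrN.
have /andP[Pge _] := P_bounds _ (leq_maxl m N).
by move=> /(le_lt_trans Pge); rewrite ltxx.
Qed.

(** * Jacobi's triple product *)

Definition qpoch a p n : K := \prod_(0 <= k < n) (1 - a * p ^+ k).

Definition qpochoo a p : K := limn (qpoch a p).

Lemma qpochS a p n : qpoch a p n.+1 = qpoch a p n * (1 - a * p ^+ n).
Proof. by rewrite /qpoch big_nat_recr. Qed.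

Lemma cvg_qpoch a p : `|p| < 1 -> qpoch a p @ \oo --> qpochoo a p.
Proof. by move=> /(abs_summable_geometric a); exact: is_cvg_prod1B. Qed.
Arguments cvg_qpoch a {p}.

Lemma qpoch_factor_neq1 a p k : `|a| < 1 -> `|p| < 1 -> a * p ^+ k != 1.
Proof.
move=> a_lt1 p_lt1; suff : `|a * p ^+ k| < 1.
  by apply: contraTneq => ->; rewrite normr1 ltxx.
by rewrite normrM normrX (le_lt_trans _ a_lt1)// ler_piMr// exprn_ile1// ltW.
Qed.

Lemma qpoch_neq0 a p n : `|a| < 1 -> `|p| < 1 -> qpoch a p n != 0.
Proof.
move=> a_lt1 p_lt1; rewrite prodf_seq_neq0; apply/allP => k _ /=.
by rewrite subr_eq0 eq_sym qpoch_factor_neq1.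
Qed.

Lemma qpochoo_neq0 a p : `|a| < 1 -> `|p| < 1 -> qpochoo a p != 0.
Proof.
move=> a_lt1 p_lt1.
apply: lim_prod1B_neq0 (abs_summable_geometric a p_lt1) _ => k.
exact: qpoch_factor_neq1.
Qed.

Lemma qpoch_multisection a p m n :
  qpoch a p (m * n) = \prod_(0 <= i < m) qpoch (a * p ^+ i) (p ^+ m) n.
Proof.
rewrite mulnC /qpoch big_nat_mul exchange_big_nat/=; apply: eq_bigr => k _.
rewrite -[(k * m)%N in LHS]add0n big_addn mulSn addnK; apply: eq_bigr => i _.
by rewrite exprD mulnC exprM mulrA.
Qed.

Lemma qpochoo_multisection a p m : `|p| < 1 -> (0 < m)%N ->
  qpochoo a p = \prod_(0 <= i < m) qpochoo (a * p ^+ i) (p ^+ m).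
Proof.
move=> p_lt1 m_gt0.
have pm_lt1 : `|p ^+ m| < 1 by rewrite normrX exprn_ilt1 -?lt0n.
have cvg_muln : muln m @ \oo --> \oo.
  apply/cvgnyPge => N; exists N => // n /= Nn.
  by rewrite (leq_trans Nn)// leq_pmull.
have /norm_cvg_lim <- := cvg_comp _ _ cvg_muln (cvg_qpoch a p_lt1).
apply: norm_cvg_lim; rewrite (_ : _ \o _ =
    fun n => \prod_(0 <= i < m) qpoch (a * p ^+ i) (p ^+ m) n).
  by apply: cvg_big => [|i _]; [exact: mul_continuous | exact: cvg_qpoch].
by apply/funext => n; exact: qpoch_multisection.
Qed.

Lemma qpochoo_mulN a p : `|p| < 1 ->
  qpochoo a p * qpochoo (- a) p = qpochoo (a ^+ 2) (p ^+ 2).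
Proof.
move=> p_lt1; apply/esym/norm_cvg_lim.
rewrite (_ : qpoch _ _ = qpoch a p \* qpoch (- a) p).
  by apply: cvgM; exact: cvg_qpoch.
apply/funext => n; rewrite /= /qpoch -big_split /=; apply: eq_bigr => k _.
by rewrite -exprM mulnC exprM; ring.
Qed.

Definition qbin p n i : K := qpoch p p n / (qpoch p p i * qpoch p p (n - i)).

Lemma qbin_bounded p : `|p| < 1 ->
  exists2 M : K, 0 <= M & forall n i, `|qbin p n i| <= M.
Proof.
move=> p_lt1; have cvg_poch := cvg_qpoch p p_lt1.
have cvg_inv : (fun n => (qpoch p p n)^-1) @ \oo --> (qpochoo p p)^-1.
  by apply: cvgV cvg_poch; exact: qpochoo_neq0.
have [A A_gt0 qA] := pinfty_ex_gt0 (cvg_seq_bounded (cvgP _ cvg_poch)).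
have [B B_gt0 qB] := pinfty_ex_gt0 (cvg_seq_bounded (cvgP _ cvg_inv)).
exists (A * (B * B)) => [|n i]; first by rewrite !mulr_ge0 ?ltW.
rewrite /qbin invfM !normrM.
by rewrite !ler_pM ?mulr_ge0//; [exact: qA | exact: qB..].
Qed.

Lemma cvg_qbin p (n i : nat -> nat) : `|p| < 1 -> n @ \oo --> \oo ->
  i @ \oo --> \oo -> (fun k => n k - i k)%N @ \oo --> \oo ->
  (fun k => qbin p (n k) (i k)) @ \oo --> (qpochoo p p)^-1.
Proof.
move=> p_lt1 noo ioo nioo; have poch_neq0 := qpochoo_neq0 p_lt1 p_lt1.
have poch_sub (m : nat -> nat) : m @ \oo --> \oo ->
    (fun k => qpoch p p (m k)) @ \oo --> qpochoo p p.
  by move=> moo; exact: cvg_comp moo (cvg_qpoch p p_lt1).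
rewrite -[_^-1]mulr1 -(mulfV poch_neq0) mulrCA -invfM.
apply: cvgM (poch_sub _ noo) (cvgV _ (cvgM (poch_sub _ ioo) (poch_sub _ nioo))).
by rewrite mulf_neq0.
Qed.

Lemma qbin_sym p n i : (i <= n)%N -> qbin p n (n - i) = qbin p n i.
Proof. by move=> ni; rewrite /qbin subKn// (mulrC (qpoch p p i)). Qed.

Lemma qbinn0 p n : `|p| < 1 -> qbin p n 0 = 1.
Proof.
by move=> p_lt1; rewrite /qbin subn0 {2}/qpoch big_geq// mul1r mulfV// qpoch_neq0.
Qed.

Lemma qbinnn p n : `|p| < 1 -> qbin p n n = 1.
Proof. by move=> p_lt1; rewrite -qbin_sym// subnn qbinn0. Qed.

Lemma qbinS p n i : `|p| < 1 -> (i < n)%N ->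
  qbin p n.+1 i.+1 = qbin p n i + p ^+ i.+1 * qbin p n i.+1.
Proof.
move=> p_lt1 lin; rewrite /qbin subSS -(subnSK lin); set m := (n - i.+1)%N.
have pn : p ^+ n = p ^+ i * (p * p ^+ m).
  by rewrite -exprS -exprD; congr (_ ^+ _); rewrite /m; lia.
have := qpoch_neq0 m.+1 p_lt1 p_lt1; have := qpoch_neq0 i.+1 p_lt1 p_lt1.
rewrite !qpochS !mulf_eq0 !negb_or pn exprS.
move=> /andP[poch_i fact_i] /andP[poch_m fact_m].
by field; rewrite poch_m poch_i fact_m fact_i.
Qed.

Definition theta_term a b (t : int) : K :=
  a ^ ((t * (t + 1)) %/ 2)%Z * b ^ ((t * (t - 1)) %/ 2)%Z.

Lemma theta_term_nat a b n :
  theta_term a b n%:Z = a ^+ 'C(n.+1, 2) * b ^+ 'C(n, 2).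
Proof.
have tri_up : n%:Z * (n%:Z + 1) = 'C(n.+1, 2)%:Z * 2.
  by have := bin2_double n; lia.
have tri_down : n%:Z * (n%:Z - 1) = 'C(n, 2)%:Z * 2.
  by case: n {tri_up} => // n; have := bin2_double n; lia.
by rewrite /theta_term tri_up tri_down !mulzK.
Qed.

Lemma theta_termN a b t : theta_term a b (- t) = theta_term b a t.
Proof.
by rewrite /theta_term mulrC; congr (_ ^ (divz _ 2) * _ ^ (divz _ 2)); ring.
Qed.

Lemma theta_term_natS a b n :
  theta_term a b n.+1%:Z = theta_term a b n%:Z * (a * (a * b) ^+ n).
Proof.
by rewrite !theta_term_nat !(binS _ 1) !bin1 !exprD exprMn exprS; ring.
Qed.

Lemma theta_term_shift a b m i :
  (a * b) ^+ i * theta_term a b (m.+1%:Z - i%:Z) =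
  a * (a * b) ^+ m * theta_term a b (m%:Z - i%:Z).
Proof.
have [/subnKC <-|/subnKC <-] := leqP i m.
  move: (m - i)%N => k; have -> : (i + k)%N.+1%:Z - i%:Z = k.+1%:Z by lia.
  have -> : (i + k)%N%:Z - i%:Z = k%:Z by lia.
  by rewrite theta_term_natS exprD; ring.
move: (i - m.+1)%N => k; have -> : m.+1%:Z - (m.+1 + k)%N%:Z = - k%:Z by lia.
have -> : m%:Z - (m.+1 + k)%N%:Z = - k.+1%:Z by lia.
by rewrite !theta_termN theta_term_natS exprD exprS (mulrC b a); ring.
Qed.

Lemma abs_summable_theta_term a b : `|a * b| < 1 ->
  abs_summable (fun n => theta_term a b n%:Z).
Proof.
move=> ab_lt1; have half_gt0 : 0 < 2^-1 :> K by rewrite invr_gt0.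
apply: (abs_summable_ratio (r := 2^-1)).
  by rewrite half_gt0 invf_lt1 ?ltr1n.
have /cvgr0_norm_le/(_ _ half_gt0) :=
  cvg_series_cvg_0 (K_complete (abs_summable_geometric a ab_lt1)).
apply: filterS => n ratio_half.
by rewrite theta_term_natS normrM mulrC ler_wpM2r.
Qed.

Lemma abs_summable_theta_term_Negz a b : `|a * b| < 1 ->
  abs_summable (fun n => theta_term a b (Negz n)).
Proof.
rewrite mulrC => /abs_summable_theta_term/abs_summableS.
by apply: abs_summable_le => n; rewrite NegzE theta_termN.
Qed.

Lemma ftheta_series a b : `|a * b| < 1 ->
  ftheta a b =
  limn (series (fun n => theta_term a b n%:Z + theta_term a b (Negz n))).
Proof.
move=> ab_lt1; rewrite -[RHS]/(limn (series (_ + _))) lim_seriesD//.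
  exact/K_complete/abs_summable_theta_term.
exact/K_complete/abs_summable_theta_term_Negz.
Qed.

(* Weighted by Gaussian binomials, the theta series absorbs a factor
   [1 + a (a b)^m] by Pascal's rule: no division by [a] or [b] is needed. *)
Definition qbin_theta_sum a b m n : K :=
  \sum_(0 <= i < n.+1) qbin (a * b) n i * theta_term a b (m%:Z - i%:Z).

Lemma qbin_theta_sumC a b m n :
  qbin_theta_sum a b m (m + n) = qbin_theta_sum b a n (m + n).
Proof.
rewrite /qbin_theta_sum big_nat_rev add0n big_nat [RHS]big_nat.
apply: eq_bigr => i /andP[_ imn].
rewrite subSS qbin_sym// (mulrC a b) -theta_termN.
by congr (_ * theta_term _ _ _); lia.
Qed.

Lemma qbin_theta_sumS a b m n : `|a * b| < 1 ->
  qbin_theta_sum a b m.+1 n.+1 =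
  (1 + a * (a * b) ^+ m) * qbin_theta_sum a b m n.
Proof.
move=> ab_lt1; rewrite mulrDl mul1r [X in _ = _ + X]mulr_sumr.
under [X in _ = _ + X]eq_bigr do rewrite mulrCA -theta_term_shift.
rewrite /qbin_theta_sum [RHS]addrC.
rewrite [LHS]big_nat_recl// [X in _ + X = _]big_nat_recr//=.
rewrite [X in _ = X + _]big_nat_recl// [X in _ = _ + X]big_nat_recr//=.
rewrite !qbinn0// !qbinnn// expr0 mul1r !mul1r -addrA; congr (_ + _).
have shiftS i : m.+1%:Z - i.+1%:Z = m%:Z - i%:Z by lia.
rewrite shiftS [RHS]addrA; congr (_ + _).
rewrite -big_split /= big_nat [RHS]big_nat.
by apply: eq_bigr => i /andP[_ ltin]; rewrite shiftS qbinS//; ring.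
Qed.

Lemma q_binomial_theorem a b n : `|a * b| < 1 ->
  qpoch (- a) (a * b) n = qbin_theta_sum a b n n.
Proof.
move=> ab_lt1; elim: n => [|n IH].
  rewrite /qpoch /qbin_theta_sum big_geq// big_nat1 qbinn0// subrr.
  by rewrite theta_term_nat mul1r mulr1.
by rewrite qbin_theta_sumS// -IH qpochS mulNr opprK mulrC.
Qed.

Lemma finite_triple_product a b m n : `|a * b| < 1 ->
  qpoch (- a) (a * b) m * qpoch (- b) (a * b) n = qbin_theta_sum a b m (m + n).
Proof.
move=> ab_lt1; elim: m => [|m IH].
  rewrite {1}/qpoch big_geq// mul1r qbin_theta_sumC mulrC.
  by apply: q_binomial_theorem; rewrite mulrC.
by rewrite addSn qbin_theta_sumS// -IH qpochS mulNr opprK; ring.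
Qed.

Lemma finite_triple_product_folded a b n : `|a * b| < 1 ->
  qpoch (- a) (a * b) n * qpoch (- b) (a * b) n.+1 =
  \sum_(0 <= k < n.+1) qbin (a * b) (n + n.+1) (n - k) *
    (theta_term a b k%:Z + theta_term a b (Negz k)).
Proof.
move=> ab_lt1; rewrite finite_triple_product// /qbin_theta_sum.
rewrite (big_cat_nat (n := n.+1)) ?ltnS ?leq_addr//=.
rewrite big_nat_rev -[X in _ + \sum_(X <= _ < _) _]add0n big_addn.
rewrite -addSn addnK add0n.
rewrite -big_split /= big_nat [RHS]big_nat; apply: eq_bigr => k /andP[_ kn].
rewrite subSS mulrDr; congr (_ * theta_term _ _ _ + _); first lia.
rewrite -qbin_sym; last lia.
by congr (qbin _ _ _ * theta_term _ _ _); lia.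
Qed.

Lemma jacobi_triple_product a b : `|a * b| < 1 ->
  ftheta a b =
  qpochoo (- a) (a * b) * qpochoo (- b) (a * b) * qpochoo (a * b) (a * b).
Proof.
set p := a * b => p_lt1; have poch_neq0 := qpochoo_neq0 p_lt1 p_lt1.
pose w k := theta_term a b k%:Z + theta_term a b (Negz k).
have ws : abs_summable w.
  apply: abs_summableD; first exact: abs_summable_theta_term.
  exact: abs_summable_theta_term_Negz.
have [M M_ge0 qbinM] := qbin_bounded p_lt1.
pose S n := \sum_(0 <= k < n.+1) qbin p (n + n.+1) (n - k) * w k.
have S_ftheta : S @ \oo --> (qpochoo p p)^-1 * ftheta a b.
  rewrite ftheta_series// -/w -[_ * _]/(_ *: (limn (series w) : K^o)).
  rewrite -lim_seriesZ; last exact: K_complete.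
  apply: (tannery (g := fun k => M * w k)).
  - exact: abs_summableZ.
  - move=> n k; rewrite [leLHS]normrM [leRHS]normrM (ger0_norm M_ge0).
    by rewrite ler_wpM2r.
  - move=> k; apply: cvgM (cvg_cst _); apply: cvg_qbin => //.
    + by apply/cvgnyPge => N; exists N => // n /=; lia.
    + exact: cvg_subnr.
    + by apply/cvgnyPge => N; exists N => // n /=; lia.
  - exact: cvg_addnl 1.
have S_qpochoo : S @ \oo --> qpochoo (- a) p * qpochoo (- b) p.
  rewrite (_ : S = fun n => qpoch (- a) p n * qpoch (- b) p n.+1).
    by apply: cvgM; [exact: cvg_qpoch | rewrite cvg_shiftS; exact: cvg_qpoch].
  by apply/funext => n; rewrite finite_triple_product_folded.
by rewrite (norm_cvg_unique S_qpochoo S_ftheta) mulrAC mulVf// mul1r.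
Qed.

(** * Identities between theta functions *)

Lemma bilateral_sumZ c (u : int -> K) :
  abs_summable (fun n => u n%:Z) -> abs_summable (fun n => u (Negz n)) ->
  bilateral_sum (fun t => c * u t) = c * bilateral_sum u.
Proof.
move=> pos_s neg_s.
have sumZ (v : K ^nat) : abs_summable v ->
    limn (series (fun n => c * v n)) = c * limn (series v).
  by move=> vs; exact: (@lim_seriesZ K v c (K_complete vs)).
by rewrite /bilateral_sum mulrDr !sumZ.
Qed.

Lemma bilateral_sum_even_odd (u : int -> K) :
  abs_summable (fun n => u n%:Z) -> abs_summable (fun n => u (Negz n)) ->
  bilateral_sum u =
  bilateral_sum (fun t => u (t * 2)) + bilateral_sum (fun t => u (t * 2 + 1)).
Proof.
move=> pos_s neg_s; rewrite /bilateral_sum.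
rewrite (lim_series_even_odd pos_s) (lim_series_even_odd neg_s).
rewrite (addrC (limn (series (fun n => u (Negz n.*2))))) addrACA.
congr (limn (series _) + limn (series _) + (limn (series _) + limn (series _)));
  by apply/funext => n; congr u; lia.
Qed.

Lemma theta_term_double a b t :
  theta_term a b (t * 2) = theta_term (a ^+ 3 * b) (a * b ^+ 3) t.
Proof.
wlog [n ->] : a b t / exists n : nat, t = n%:Z.
  move=> th; case: t => n; first by apply: th; exists n.
  rewrite NegzE mulNr !theta_termN th; last by exists n.+1.
  by congr theta_term; ring.
rewrite (_ : n%:Z * 2 = n.*2%:Z); last lia.
rewrite !theta_term_nat bin2_odd bin2_even.
(* [exprD] would unfold the binomials into sums. *)
move: 'C(n.+1, 2) 'C(n, 2) => i j.
by rewrite !exprD !exprM !exprMn; ring.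
Qed.

Lemma theta_term_double_add1 a e t :
  theta_term a (a * e) (t * 2 + 1) = a * theta_term (a ^+ 8 * e ^+ 3) e t.
Proof.
have exp_a n : ('C(n.*2.+2, 2) + 'C(n.*2.+1, 2) = 1 + 'C(n.+1, 2) * 8)%N.
  by move: (bin2_double n) (bin2_double n.*2.+1) (bin2_double n.*2); lia.
case: t => n.
  rewrite (_ : n%:Z * 2 + 1 = n.*2.+1%:Z); last lia.
  rewrite !theta_term_nat [in LHS]exprMn [LHS]mulrA -(exprD a) exp_a bin2_odd.
  move: 'C(n.+1, 2) 'C(n, 2) => i j.
  by rewrite !exprD !exprM !exprMn; ring.
rewrite NegzE (_ : - n.+1%:Z * 2 + 1 = - n.*2.+1%:Z); last lia.
rewrite !theta_termN !theta_term_nat [in LHS]exprMn [LHS]mulrAC.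
rewrite -(exprD a) exp_a -doubleS bin2_even.
move: 'C(n.+2, 2) 'C(n.+1, 2) => i j.
by rewrite !exprD !exprM !exprMn; ring.
Qed.

Lemma ftheta_even_odd a e : `|a ^+ 2 * e| < 1 ->
  ftheta a (a * e) =
  ftheta (a ^+ 4 * e) (a ^+ 4 * e ^+ 3) + a * ftheta (a ^+ 8 * e ^+ 3) e.
Proof.
move=> a2e_lt1; have ab_lt1 : `|a * (a * e)| < 1 by rewrite mulrA -expr2.
have odd_lt1 : `|a ^+ 8 * e ^+ 3 * e| < 1.
  by rewrite (_ : _ * e = (a ^+ 2 * e) ^+ 4) ?normrX ?exprn_ilt1//; ring.
rewrite [LHS](bilateral_sum_even_odd (u := theta_term a (a * e))); last 2 first.
- exact: abs_summable_theta_term.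
- exact: abs_summable_theta_term_Negz.
congr (_ + _).
  congr bilateral_sum; apply/funext => t; rewrite theta_term_double.
  by congr theta_term; ring.
rewrite -[RHS](bilateral_sumZ a (u := theta_term (a ^+ 8 * e ^+ 3) e));
  last 2 first.
- exact: abs_summable_theta_term.
- exact: abs_summable_theta_term_Negz.
by congr bilateral_sum; apply/funext => t; exact: theta_term_double_add1.
Qed.

Lemma qpochoo_even_odd a p : `|p| < 1 ->
  qpochoo a p = qpochoo a (p ^+ 2) * qpochoo (a * p) (p ^+ 2).
Proof.
move=> p_lt1; rewrite (qpochoo_multisection a (m := 2))//.
by rewrite big_nat_recr//= big_nat1 mulr1.
Qed.

Lemma psi_mul_qpochoo p : `|p| < 1 ->
  psi p * qpochoo p (p ^+ 2) = qpochoo (p ^+ 2) (p ^+ 2).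
Proof.
move=> p_lt1; have p2_lt1 : `|p ^+ 2| < 1 by rewrite normrX exprn_ilt1.
have minus_p : qpochoo (- p) (p ^+ 2) =
    qpochoo (- p) (p ^+ 4) * qpochoo (- p ^+ 3) (p ^+ 4).
  by rewrite qpochoo_even_odd// mulNr -exprS -exprM.
rewrite /psi jacobi_triple_product -exprS ?normrX ?exprn_ilt1// -minus_p.
rewrite mulrAC [X in X * _]mulrC qpochoo_mulN// [RHS]qpochoo_even_odd//.
by rewrite -exprD -exprM.
Qed.

Lemma ftheta_mulN a b : `|a * b| < 1 ->
  ftheta a b * ftheta (- a) (- b) =
  phi (- (a * b)) * ftheta (- a ^+ 2) (- b ^+ 2).
Proof.
set p := a * b => p_lt1.
have p2_lt1 : `|p ^+ 2| < 1 by rewrite normrX exprn_ilt1.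
have opp_ab : - a * - b = p by rewrite mulrNN.
have opp_sqr_ab : - a ^+ 2 * - b ^+ 2 = p ^+ 2 by rewrite mulrNN exprMn.
have opp_sqr_p : - p * - p = p ^+ 2 by rewrite mulrNN.
rewrite /phi !jacobi_triple_product ?opp_ab ?opp_sqr_ab ?opp_sqr_p//.
rewrite !opprK -/p.
rewrite -(qpochoo_mulN a p_lt1) -(qpochoo_mulN b p_lt1).
rewrite (qpochoo_even_odd p p_lt1).
by rewrite -[p * p]/(p ^+ 2); ring.
Qed.

Lemma psi_mul_ftheta a b : `|a * b| < 1 ->
  psi (a * b) * ftheta a b =
  ftheta a (a * b ^+ 2) * ftheta b (a ^+ 2 * b).
Proof.
set p := a * b => p_lt1.
have p2_lt1 : `|p ^+ 2| < 1 by rewrite normrX exprn_ilt1.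
have ab2 : a * (a * b ^+ 2) = p ^+ 2 by rewrite /p; ring.
have ba2 : b * (a ^+ 2 * b) = p ^+ 2 by rewrite /p; ring.
have ap : - a * p = - (a ^+ 2 * b) by rewrite /p; ring.
have bp : - b * p = - (a * b ^+ 2) by rewrite /p; ring.
rewrite !jacobi_triple_product ?ab2 ?ba2// -/p.
rewrite (qpochoo_even_odd p p_lt1) mulrCA [psi p * _]mulrA psi_mul_qpochoo//.
rewrite (qpochoo_even_odd (- a) p_lt1) (qpochoo_even_odd (- b) p_lt1) ap bp.
by rewrite -[p * p]/(p ^+ 2); ring.
Qed.

Lemma fthetaC a b : `|a * b| < 1 -> ftheta a b = ftheta b a.
Proof.
move=> ab_lt1; rewrite !jacobi_triple_product// 1?(mulrC b a)//.
by rewrite [X in X * _]mulrC.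
Qed.

Lemma ftheta_sqr_sub s e : `|s ^+ 2 * e| < 1 ->
  ftheta (s ^+ 4 * e) (s ^+ 4 * e ^+ 3) ^+ 2 -
    (s * ftheta (s ^+ 8 * e ^+ 3) e) ^+ 2 =
  phi (- (s ^+ 2 * e)) * ftheta (- s ^+ 2) (- (s ^+ 2 * e ^+ 2)).
Proof.
move=> s2e_lt1; have plus := ftheta_even_odd s2e_lt1.
have := @ftheta_even_odd (- s) e; rewrite sqrrN => /(_ s2e_lt1).
have -> : (- s) ^+ 4 = s ^+ 4 by ring.
have -> : (- s) ^+ 8 = s ^+ 8 by ring.
rewrite !mulNr => minus; rewrite subr_sqr -plus -minus mulrC ftheta_mulN.
  by rewrite exprMn mulrA -expr2.
by rewrite mulrA -expr2.
Qed.

Lemma theta_quotient_inv_sub s z : `|s ^+ 2 * z| < 1 ->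
  let S := s * (ftheta (- z) (- (s ^+ 8 * z ^+ 3)) /
                ftheta (- (s ^+ 4 * z)) (- (s ^+ 4 * z ^+ 3))) in
  S^-1 - S = phi (s ^+ 2 * z) * ftheta (- s ^+ 2) (- (s ^+ 2 * z ^+ 2)) /
    (s * psi (s ^+ 4 * z ^+ 2) * ftheta (- z) (- (s ^+ 4 * z))).
Proof.
move=> s2z_lt1; rewrite /= mulrA inv_sub_div.
have s4z2 : - z * - (s ^+ 4 * z) = (s ^+ 2 * z) ^+ 2 by ring.
have s8z4 : - z * - (s ^+ 8 * z ^+ 3) = (s ^+ 2 * z) ^+ 4 by ring.
have zN3 : (- z) ^+ 3 = - z ^+ 3 by ring.
congr (_ / _).
  rewrite (@fthetaC (- z)) ?s8z4 ?normrX ?exprn_ilt1//.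
  have := @ftheta_sqr_sub s (- z).
  by rewrite zN3 sqrrN !mulrN !opprK normrN => /(_ s2z_lt1).
rewrite -[LHS]mulrA -[RHS]mulrA; congr (_ * _).
have := @psi_mul_ftheta (- z) (- (s ^+ 4 * z)).
rewrite s4z2 normrX exprn_ilt1// => /(_ isT); rewrite exprMn -(exprM s) => ->.
by congr (ftheta _ _ * ftheta _ _); ring.
Qed.

(** * Theta functions of order seven *)

(* Here [x = q^(1/4)] and [y = q^(1/2)]. *)
Definition septic_quotient x y k : K :=
  x ^+ k * (ftheta (- y ^+ (7 - k)) (- y ^+ (21 + k)) /
            ftheta (- y ^+ (7 + k)) (- y ^+ (21 - k))).

Lemma S1E x y : S1 x (y ^+ 2) = septic_quotient x y 1.
Proof. by rewrite /S1 -!exprM. Qed.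

Lemma S2E x y : S2 x (y ^+ 2) = septic_quotient x y 3.
Proof. by rewrite /S2 -!exprM. Qed.

Lemma S3E x y : S3 x (y ^+ 2) = septic_quotient x y 5.
Proof. by rewrite /S3 -!exprM. Qed.

Lemma septic_quotient_inv_sub x y k : x ^+ 2 = y -> `|y| < 1 -> (k < 7)%N ->
  (septic_quotient x y k)^-1 - septic_quotient x y k =
  phi (y ^+ 7) * ftheta (- y ^+ k) (- y ^+ (14 - k)) /
    (x ^+ k * psi (y ^+ 14) * ftheta (- y ^+ (7 - k)) (- y ^+ (7 + k))).
Proof.
move=> xy y_lt1 k_lt7; rewrite /septic_quotient.
set s := x ^+ k; set z := y ^+ (7 - k).
have s_sqr : s ^+ 2 = y ^+ k by rewrite -xy -!exprM mulnC.
have yE i j n : (k * i + (7 - k) * j)%N = n -> y ^+ n = s ^+ (2 * i) * z ^+ j.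
  by move=> <-; rewrite exprD !exprM s_sqr.
have y7E : y ^+ 7 = s ^+ 2 * z by rewrite (yE 1 1)//; lia.
have -> : y ^+ 14 = s ^+ 4 * z ^+ 2 by rewrite (yE 2 2)//; lia.
have -> : y ^+ (14 - k) = s ^+ 2 * z ^+ 2 by rewrite (yE 1 2)//; lia.
have -> : y ^+ (7 + k) = s ^+ 4 * z by rewrite (yE 2 1)//; lia.
have -> : y ^+ (21 - k) = s ^+ 4 * z ^+ 3 by rewrite (yE 2 3)//; lia.
have -> : y ^+ (21 + k) = s ^+ 8 * z ^+ 3 by rewrite (yE 4 3)//; lia.
by rewrite y7E -s_sqr -theta_quotient_inv_sub// -y7E normrX exprn_ilt1.
Qed.

(* Replacing [q^(1/4)] by [i q^(1/4)] turns each relation for [1/S - S] into the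
   one for [1/S + S]. *)
Lemma septic_quotient_inv_add_rotate (i x y : K) k :
  i ^+ 2 = -1 -> odd k -> (k < 7)%N ->
  (septic_quotient x y k)^-1 + septic_quotient x y k =
  i ^+ k * ((septic_quotient (i * x) (- y) k)^-1 -
            septic_quotient (i * x) (- y) k).
Proof.
move=> i_sqr k_odd k_lt7.
have -> : septic_quotient (i * x) (- y) k = i ^+ k * septic_quotient x y k.
  by rewrite /septic_quotient exprMn -mulrA !exprN_even//; lia.
have : i ^+ k * i ^+ k = -1 by rewrite -exprMn -expr2 i_sqr -signr_odd k_odd.
have := expf_neq0 k (sqrN1_neq0 i_sqr).
move: (i ^+ k) (septic_quotient x y k) => c S c_neq0 c_sqr.
by rewrite mulrBr invfM !mulrA mulfV// c_sqr mul1r mulN1r opprK.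
Qed.

Lemma septic_quotient_inv_add (i x y : K) k :
  i ^+ 2 = -1 -> x ^+ 2 = y -> `|y| < 1 -> odd k -> (k < 7)%N ->
  (septic_quotient x y k)^-1 + septic_quotient x y k =
  phi (- y ^+ 7) * ftheta (y ^+ k) (y ^+ (14 - k)) /
    (x ^+ k * psi (y ^+ 14) * ftheta (- y ^+ (7 - k)) (- y ^+ (7 + k))).
Proof.
move=> i_sqr xy y_lt1 k_odd k_lt7.
rewrite (septic_quotient_inv_add_rotate x y i_sqr k_odd k_lt7).
have ixNy : (i * x) ^+ 2 = - y by rewrite exprMn i_sqr xy mulN1r.
rewrite septic_quotient_inv_sub ?normrN//.
have odd14B : odd (14 - k) by lia.
have [even7B even7D] : ~~ odd (7 - k) /\ ~~ odd (7 + k) by split; lia.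
rewrite !(exprN_odd y (n := 7), exprN_odd y k_odd, exprN_odd y odd14B)//.
rewrite !(exprN_even y (n := 14), exprN_even y even7B, exprN_even y even7D)//.
rewrite !opprK exprMn -2!(mulrA (i ^+ k)).
by rewrite mulf_div_cancel// expf_neq0// sqrN1_neq0.
Qed.

Lemma ftheta_prod_quotient q : `|q| < 1 ->
  ftheta (- q) (- q ^+ 13) * ftheta (- q ^+ 3) (- q ^+ 11) *
    ftheta (- q ^+ 5) (- q ^+ 9) /
  (ftheta (- q ^+ 6) (- q ^+ 8) * ftheta (- q ^+ 4) (- q ^+ 10) *
    ftheta (- q ^+ 2) (- q ^+ 12)) = psi (q ^+ 7) / psi q.
Proof.
move=> q_lt1; have qX n : `|q ^+ n.+1| < 1 by rewrite normrX exprn_ilt1.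
pose P i := qpochoo (q ^+ i) (q ^+ 14).
have P_neq0 i : P i.+1 != 0 by exact: qpochoo_neq0.
have odd_P : qpochoo q (q ^+ 2) = P 1 * P 3 * P 5 * P 7 * P 9 * P 11 * P 13.
  rewrite (qpochoo_multisection _ (m := 7))//.
  by rewrite !big_nat_recr//= big_geq// mul1r -!exprM -!exprS.
have even_P : qpochoo (q ^+ 2) (q ^+ 2) =
    P 2 * P 4 * P 6 * P 8 * P 10 * P 12 * P 14.
  rewrite (qpochoo_multisection _ (m := 7))//.
  by rewrite !big_nat_recr//= big_geq// mul1r -!exprM -!exprD.
have psi_q : psi q = P 2 * P 4 * P 6 * P 8 * P 10 * P 12 * P 14 /
    (P 1 * P 3 * P 5 * P 7 * P 9 * P 11 * P 13).
  by rewrite -odd_P -even_P -psi_mul_qpochoo// mulfK// qpochoo_neq0.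
have psi_q7 : psi (q ^+ 7) = P 14 / P 7.
  have := psi_mul_qpochoo (qX 6); rewrite -exprM => psi7.
  by rewrite /P -psi7 mulfK// (P_neq0 6).
have ftheta_P i j : (i + j = 14)%N ->
    ftheta (- q ^+ i) (- q ^+ j) = P i * P j * P 14.
  move=> ij.
  have ijE : - q ^+ i * - q ^+ j = q ^+ 14 by rewrite mulrNN -exprD ij.
  by rewrite jacobi_triple_product ijE// !opprK.
rewrite -[X in ftheta (- X) (- _ ^+ 13)]expr1 !ftheta_P// psi_q psi_q7.
by field; rewrite !P_neq0.
Qed.

Lemma septic_quotient_prod_inv_sub x y : x ^+ 2 = y -> `|y| < 1 ->
  ((septic_quotient x y 1)^-1 - septic_quotient x y 1) *
  ((septic_quotient x y 3)^-1 - septic_quotient x y 3) *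
  ((septic_quotient x y 5)^-1 - septic_quotient x y 5) =
  phi (y ^+ 7) ^+ 3 * psi (y ^+ 7) / (x ^+ 9 * psi (y ^+ 14) ^+ 3 * psi y).
Proof.
move=> xy y_lt1; rewrite !septic_quotient_inv_sub//.
transitivity (phi (y ^+ 7) ^+ 3 / (x ^+ 9 * psi (y ^+ 14) ^+ 3) *
    (psi (y ^+ 7) / psi y)).
  by rewrite -ftheta_prod_quotient// !invfM; ring.
by rewrite !invfM; ring.
Qed.

Lemma septic_quotient_prod_inv_add (i x y : K) :
  i ^+ 2 = -1 -> x ^+ 2 = y -> `|y| < 1 ->
  ((septic_quotient x y 1)^-1 + septic_quotient x y 1) *
  ((septic_quotient x y 3)^-1 + septic_quotient x y 3) *
  ((septic_quotient x y 5)^-1 + septic_quotient x y 5) =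
  phi (- y ^+ 7) ^+ 3 * psi (- y ^+ 7) /
    (x ^+ 9 * psi (y ^+ 14) ^+ 3 * psi (- y)).
Proof.
move=> i_sqr xy y_lt1; rewrite !(septic_quotient_inv_add_rotate x y i_sqr)//.
have ixNy : (i * x) ^+ 2 = - y by rewrite exprMn i_sqr xy mulN1r.
have Ny_lt1 : `|- y| < 1 by rewrite normrN.
have := septic_quotient_prod_inv_sub ixNy Ny_lt1.
rewrite (exprN_odd y (n := 7))// (exprN_even y (n := 14))// exprMn.
move: (_ - _) (_ - _) (_ - _) => T5 T3 T1 prodT.
have -> : i ^+ 1 * T1 * (i ^+ 3 * T3) * (i ^+ 5 * T5) =
    i ^+ 9 * (T1 * T3 * T5) by ring.
rewrite prodT -2!(mulrA (i ^+ 9)).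
by rewrite mulf_div_cancel// expf_neq0// sqrN1_neq0.
Qed.

End AbsComplete.

(** * Completeness of the complex numbers *)

Lemma real_abs_complete (R : realType) : abs_complete R.
Proof.
move=> u [M uM]; apply: normed_cvg; apply: nondecreasing_is_cvgn.
  by apply: nondecreasing_series => n _ _; exact: normr_ge0.
by exists M => _ [n _ <-]; exact: uM.
Qed.

Section ComplexComplete.
Variable R : realType.
(* The topology of [R[i]] is only found through its [numFieldType] structure. *)
Let C : numFieldType := R[i].

Lemma cvg_real_complex (v : R ^nat) (l : R) :
  v @ \oo --> l ->
  (fun n => real_complex R (v n) : C) @ \oo --> (real_complex R l : C).
Proof.
move=> /cvgrPdist_lt vl; apply/cvgrPdist_lt => e e_gt0.
have eE : e = (complex.Re e)%:C%C by rewrite RRe_real// gtr0_real.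
have /vl : 0 < complex.Re e by rewrite -ltcR -eE.
apply: filterS => n; rewrite eE -rmorphB /=.
by rewrite normc_def /= expr0n addr0 sqrtr_sqr ltcR.
Qed.

Lemma normc_ge_Im (z : R[i]) : `|complex.Im z|%:C%C <= `|z|.
Proof.
have := normc_ge_Re (z * 'i%C); rewrite ReiNIm normrN normrM.
by rewrite [`|'i%C|]normc_def /= expr0n add0r expr1n sqrtr1 mulr1.
Qed.

Lemma complex_abs_complete : abs_complete R[i].
Proof.
move=> u [M uM].
have part_cvg (part : {additive R[i] -> R}) :
    (forall z, `|part z|%:C%C <= `|z|) ->
    cvgn (fun n => real_complex R (part (series u n)) : C).
  move=> part_le; have : abs_summable (part \o u).
    exists (complex.Re M) => n; rewrite -lecR RRe_real; last first.
      by rewrite (ger0_real (le_trans _ (uM 0%N))) ?big_nil.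
    apply: le_trans (uM n); rewrite rmorph_sum.
    by apply: ler_sum => k _; exact: part_le.
  move=> /real_abs_complete/cvg_ex[/= l part_l]; apply: (cvgP (l%:C%C : C)).
  apply: cvg_real_complex.
  rewrite (_ : (fun n => _) = series (part \o u))//.
  by apply/funext => n; exact: raddf_sum.
have -> : series u = (fun n => real_complex R (complex.Re (series u n)) : C) +
    (fun n => 'i%C * (real_complex R (complex.Im (series u n))) : C).
  by apply/funext => n; exact: complexE.
apply: is_cvgD; first exact: part_cvg (@normc_ge_Re R).
apply: is_cvgM; first exact: is_cvg_cst.
exact: part_cvg normc_ge_Im.
Qed.

End ComplexComplete.

Local Open Scope complex_scope.

Theorem theorem2p1 (R : realType) (q q12 q14 : R[i])
    (hq : `|q| < 1) (hq12 : q12 ^+ 2 = q) (hq14 : q14 ^+ 2 = q12) :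
  (* (i) *)
  ((S1 q14 q)^-1 - S1 q14 q =
    (phi (q12 ^+ 7) * ftheta (- q12) (- q12 ^+ 13)) /
      (q14 * psi (q ^+ 7) * ftheta (- q ^+ 3) (- q ^+ 4))) /\
  (* (ii) *)
  ((S1 q14 q)^-1 + S1 q14 q =
    (phi (- q12 ^+ 7) * ftheta q12 (q12 ^+ 13)) /
      (q14 * psi (q ^+ 7) * ftheta (- q ^+ 3) (- q ^+ 4))) /\
  (* (iii) *)
  ((S2 q14 q)^-1 - S2 q14 q =
    (phi (q12 ^+ 7) * ftheta (- q12 ^+ 3) (- q12 ^+ 11)) /
      (q14 ^+ 3 * psi (q ^+ 7) * ftheta (- q ^+ 2) (- q ^+ 5))) /\
  (* (iv) *)
  ((S2 q14 q)^-1 + S2 q14 q =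
    (phi (- q12 ^+ 7) * ftheta (q12 ^+ 3) (q12 ^+ 11)) /
      (q14 ^+ 3 * psi (q ^+ 7) * ftheta (- q ^+ 2) (- q ^+ 5))) /\
  (* (v) *)
  ((S3 q14 q)^-1 - S3 q14 q =
    (phi (q12 ^+ 7) * ftheta (- q12 ^+ 5) (- q12 ^+ 9)) /
      (q14 ^+ 5 * psi (q ^+ 7) * ftheta (- q) (- q ^+ 6))) /\
  (* (vi) *)
  ((S3 q14 q)^-1 + S3 q14 q =
    (phi (- q12 ^+ 7) * ftheta (q12 ^+ 5) (q12 ^+ 9)) /
      (q14 ^+ 5 * psi (q ^+ 7) * ftheta (- q) (- q ^+ 6))) /\
  (* (vii); the chosen fourth root of q^2 is q^(1/2) *)
  (((S1 q12 (q ^+ 2))^-1 - S1 q12 (q ^+ 2)) *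
   ((S2 q12 (q ^+ 2))^-1 - S2 q12 (q ^+ 2)) *
   ((S3 q12 (q ^+ 2))^-1 - S3 q12 (q ^+ 2)) =
    (phi (q ^+ 7) ^+ 3 * psi (q ^+ 7)) /
      (q12 ^+ 9 * psi (q ^+ 14) ^+ 3 * psi q)) /\
  (* (viii) *)
  (((S1 q12 (q ^+ 2))^-1 + S1 q12 (q ^+ 2)) *
   ((S2 q12 (q ^+ 2))^-1 + S2 q12 (q ^+ 2)) *
   ((S3 q12 (q ^+ 2))^-1 + S3 q12 (q ^+ 2)) =
    (phi (- q ^+ 7) ^+ 3 * psi (- q ^+ 7)) /
      (q12 ^+ 9 * psi (q ^+ 14) ^+ 3 * psi (- q))).
Proof.
have K_complete := complex_abs_complete (R := R).
have q12_lt1 : `|q12| < 1 by rewrite -(expr_lt1 (n := 2))// -normrX hq12.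
have i_sqr := sqr_i R.
have inv_sub k := septic_quotient_inv_sub K_complete hq14 q12_lt1 (k := k).
have inv_add k := septic_quotient_inv_add K_complete i_sqr hq14 q12_lt1 (k := k).
have prod_sub := septic_quotient_prod_inv_sub K_complete hq12 hq.
have prod_add := septic_quotient_prod_inv_add K_complete i_sqr hq12 hq.
split; first by rewrite -hq12 S1E -!exprM; exact: (inv_sub 1).
split; first by rewrite -hq12 S1E -!exprM; exact: (inv_add 1).
split; first by rewrite -hq12 S2E -!exprM; exact: (inv_sub 3).
split; first by rewrite -hq12 S2E -!exprM; exact: (inv_add 3).
split; first by rewrite -hq12 S3E -!exprM; exact: (inv_sub 5).
split; first by rewrite -hq12 S3E -!exprM; exact: (inv_add 5).
by rewrite S1E S2E S3E; split; [exact: prod_sub | exact: prod_add].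
Qed.
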